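(* For $n\ge 1$ let $\tau_n$ denote the kissing number in $\mathbb{R}^n$, i.e. the maximal number $N$ of points $x_1,\dots,x_N$ on the unit sphere $S^{n-1}\subset\mathbb{R}^n$ with $\langle x_i,x_j\rangle\le 1/2$ for all $i\neq j$. Then $\tau_{25}\ge 197048$, $\tau_{26}\ge 198512$, $\tau_{27}\ge 199976$, $\tau_{28}\ge 204368$, $\tau_{29}\ge 208272$, $\tau_{30}\ge 219984$, and $\tau_{31}\ge 232874$.
   Context: The kissing number in $\mathbb{R}^n$ is equivalently the maximal number of non-overlapping unit balls that are externally tangent to a fixed unit ball. *)

(* Defs.v *)
From HB Require Import structures.
From mathcomp Require Import all_boot all_order all_algebra.
From mathcomp Require Import reals.
From Stdlib Require Export BinNums PosDef NArith.BinNatDef.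
Set Implicit Arguments. Unset Strict Implicit. Unset Printing Implicit Defensive.
Import Order.TTheory GRing.Theory Num.Theory.
Local Open Scope ring_scope.

Definition dotp (R : realType) (n : nat) (u v : 'rV[R]_n) : R :=
  \sum_(k < n) u 0 k * v 0 k.

Definition kissing_config (R : realType) (n N : nat) (x : 'I_N -> 'rV[R]_n) : Prop :=
  (forall i, dotp (x i) (x i) = 1) /\
  (forall i j, i != j -> dotp (x i) (x j) <= 1 / 2).

(* N is given in binary (BinNat.N, scope %num) to avoid building huge unary
   nat literals; it is coerced to nat via nat_of_bin. *)
Definition kissing_number_ge (R : realType) (n : nat) (N : BinNums.N) : Prop :=
  exists x : 'I_(nat_of_bin N) -> 'rV[R]_n, kissing_config x.

(* Main.v *)
(** Normalize the 196560 minimal vectors of the Leech lattice to length 1; their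
    pairwise inner products are then at most 1/2. Let S_1, ..., S_m be disjoint
    sets of minimal vectors such that the inner products within each S_i are at
    most 1/4, and let T_1, ..., T_m be disjoint equilateral triangles inscribed
    in great circles, whose vertices together form a kissing configuration in
    R^k. Replace each x in S_i by the three vectors (sqrt(2/3) x, sqrt(1/3) y)
    with y in T_i. The inner product of two new vectors is at most
    2/3 - 1/3 * 1/2 if x = x', at most 2/3 * 1/4 + 1/3 if x and x' are distinct
    elements of the same S_i, and at most 2/3 * 1/2 + 1/3 * 1/2 otherwise, that
    is, always at most 1/2. So 2 (|S_1| + ... + |S_m|) points are gained in
    R^(24+k). The triangles come from the root systems A2, D3, D4, D5, E6 and
    E7; for k = 1 an antipodal pair takes the role of the triangle. The S_i are
    images under automorphisms of a single set of 498 vectors, with overlaps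
    removed. *)
From Stdlib Require Import ZArith.
Require Import Defs.
From mathcomp Require Import all_boot all_order all_algebra reals.
From mathcomp Require Import zify ssrZ ring lra.
Set Implicit Arguments.
Unset Strict Implicit.
Unset Printing Implicit Defensive.
Import Order.TTheory GRing.Theory Num.Theory.

Local Open Scope Z_scope.
Local Arguments Z.add : simpl never.
Local Arguments Z.sub : simpl never.
Local Arguments Z.mul : simpl never.

(** * Integer vectors as lists: inner products, coordinate sums, permutations of coordinates *)

Fixpoint dot (x y : seq Z) : Z :=
  if x is a :: x' then if y is b :: y' then a * b + dot x' y' else 0 else 0.

Definition zsum (x : seq Z) : Z := foldr Z.add 0 x.

Fixpoint vsub (x y : seq Z) : seq Z :=
  if x is a :: x' then if y is b :: y' then a - b :: vsub x' y' else [::]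
  else [::].

Lemma dotC x y : dot x y = dot y x.
Proof. by elim: x y => [|a x IH] [|b y] //=; rewrite IH Z.mul_comm. Qed.

Lemma dot_ge0 x : 0 <= dot x x.
Proof. elim: x => //= a x; nia. Qed.

Lemma dot_vsub x y : size x = size y ->
  dot (vsub x y) (vsub x y) = dot x x + dot y y - 2 * dot x y.
Proof.
elim: x y => [|a x IH] [|b y] //= [/IH ->]; ring.
Qed.

Lemma vsub_eq0 x y :
  size x = size y -> dot (vsub x y) (vsub x y) = 0 -> x = y.
Proof.
elim: x y => [|a x IH] [|b y] //= [sxy] h.
have h0 := @dot_ge0 (vsub x y).
have h1 := Z.square_nonneg (a - b).
have /Z.mul_eq_0 ab : (a - b) * (a - b) = 0 by lia.
by rewrite (IH y) //; last lia; congr cons; lia.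
Qed.

Lemma zsum_vsub x y : size x = size y -> zsum (vsub x y) = zsum x - zsum y.
Proof. elim: x y => [|a x IH] [|b y] //= [/IH ->]; lia. Qed.

Definition coord_map (T : Type) (x0 : T) (p : seq nat) (x : seq T) : seq T :=
  [seq nth x0 x i | i <- p].

Lemma dot_map (f g : nat -> Z) p :
  dot (map f p) (map g p) = (\sum_(i <- p) (f i * g i))%R.
Proof. by elim: p => [|i p IH]; rewrite ?big_nil ?big_cons //= IH. Qed.

Lemma zsum_map (f : nat -> Z) p : zsum (map f p) = (\sum_(i <- p) f i)%R.
Proof. by elim: p => [|i p IH]; rewrite ?big_nil ?big_cons //= IH. Qed.

Lemma coord_map_id n (x : seq Z) :
  size x = n -> x = coord_map 0 (iota 0 n) x.
Proof. by move<-; rewrite -[LHS](mkseq_nth 0). Qed.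

Lemma dot_coord_map n p x y : perm_eq p (iota 0 n) -> size x = n ->
  size y = n -> dot (coord_map 0 p x) (coord_map 0 p y) = dot x y.
Proof.
move=> pn sx sy; rewrite [in RHS](coord_map_id sx) [in RHS](coord_map_id sy).
by rewrite !dot_map; apply: perm_big.
Qed.

Lemma zsum_coord_map n p x : perm_eq p (iota 0 n) -> size x = n ->
  zsum (coord_map 0 p x) = zsum x.
Proof.
move=> pn sx; rewrite [in RHS](coord_map_id sx) !zsum_map.
exact: perm_big.
Qed.

(** * The binary Golay code *)

Fixpoint xorw (c d : bitseq) : bitseq :=
  if c is a :: c' then if d is b :: d' then (a (+) b) :: xorw c' d' else [::]
  else [::].

Fixpoint parity (u v : bitseq) : bool :=
  if u is a :: u' then if v is b :: v' then (a && b) (+) parity u' v' else false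
  else false.

Definition wt (c : bitseq) : nat := count id c.

Fixpoint words n : seq bitseq :=
  if n is n'.+1 then map (cons false) (words n') ++ map (cons true) (words n')
  else [:: [::]].

Lemma mem_words n c : (c \in words n) = (size c == n).
Proof.
have cons_inj b : injective (cons b : bitseq -> bitseq) by move=> ? ? [].
have consN b b' d s : b != b' -> (b :: d : bitseq) \in map (cons b') s = false.
  by move=> bb; apply/mapP => -[e _ [ee _]]; rewrite ee eqxx in bb.
elim: n c => [|n IH] [|[] c] //=; rewrite mem_cat.
- by apply/negP => /orP[] /mapP[].
- by rewrite consN // mem_map // IH.
- by rewrite mem_map // consN // orbF IH.
Qed.

Lemma words_uniq n : uniq (words n).
Proof.
have cons_inj b : injective (cons b : bitseq -> bitseq) by move=> ? ? [].
elim: n => //= n IH; rewrite cat_uniq !map_inj_uniq // IH /= andbT.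
by apply/hasPn => c /mapP[d _ ->]; apply/mapP => -[].
Qed.

Lemma size_words n : size (words n) = (2 ^ n)%N.
Proof.
by elim: n => //= n IH; rewrite size_cat !size_map IH expnS mul2n addnn.
Qed.

Lemma size_xorw c d : size c = size d -> size (xorw c d) = size d.
Proof. by elim: c d => [|a c IH] [|b d] //= [/IH ->]. Qed.

Lemma take_xorw n c d : take n (xorw c d) = xorw (take n c) (take n d).
Proof. by elim: n c d => [|n IH] [|a c] [|b d] //=; rewrite IH. Qed.

Lemma drop_xorw n c d : drop n (xorw c d) = xorw (drop n c) (drop n d).
Proof.
elim: n c d => [|n IH] [|a c] [|b d] //=.
by case: (drop n c).
Qed.

Lemma xorw_map (T : Type) (f g : T -> bool) s :
  xorw (map f s) (map g s) = [seq f i (+) g i | i <- s].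
Proof. by elim: s => //= i s ->. Qed.

Lemma parity_xorw u c d :
  size c = size d -> parity u (xorw c d) = parity u c (+) parity u d.
Proof.
elim: u c d => [|a u IH] [|b c] [|e d] //= [/IH ->].
by case: a; case: b; case: e; case: (parity u c); case: (parity u d).
Qed.

(* Coordinates 0, ..., 22 are the residues mod 23 and coordinate 23 is the
   point at infinity of the extended quadratic residue code; the matrix gives
   its last twelve coordinates as linear functions of the first twelve. *)
Definition golay_matrix : seq bitseq := map (map odd)
  [:: [:: 1; 0; 1; 0; 0; 1; 0; 0; 1; 1; 1; 1];
      [:: 1; 1; 1; 1; 0; 1; 1; 0; 1; 0; 0; 0];
      [:: 0; 1; 1; 1; 1; 0; 1; 1; 0; 1; 0; 0];
      [:: 0; 0; 1; 1; 1; 1; 0; 1; 1; 0; 1; 0];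
      [:: 0; 0; 0; 1; 1; 1; 1; 0; 1; 1; 0; 1];
      [:: 1; 0; 1; 0; 1; 0; 1; 1; 1; 0; 0; 1];
      [:: 1; 1; 1; 1; 0; 0; 0; 1; 0; 0; 1; 1];
      [:: 1; 1; 0; 1; 1; 1; 0; 0; 0; 1; 1; 0];
      [:: 0; 1; 1; 0; 1; 1; 1; 0; 0; 0; 1; 1];
      [:: 1; 0; 0; 1; 0; 0; 1; 1; 1; 1; 1; 0];
      [:: 0; 1; 0; 0; 1; 0; 0; 1; 1; 1; 1; 1];
      [:: 1; 1; 0; 0; 0; 1; 1; 1; 0; 1; 0; 1]]%N.

Definition encode (m : bitseq) : bitseq :=
  [seq parity row m | row <- golay_matrix].

Definition golay (c : bitseq) : bool :=
  (size c == 24%N) && (drop 12 c == encode (take 12 c)).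

Definition golay_words : seq bitseq := [seq m ++ encode m | m <- words 12].

Definition octads : seq bitseq := [seq c <- golay_words | wt c == 8%N].

(** The translation [i -> i + 1] of the residues mod 23, fixing infinity: [coord_map] reads the new
    entry at place j from place [p_j]. *)
Definition shift_perm : seq nat := [:: 22%N] ++ iota 0 22 ++ [:: 23%N].

(** The map [i -> 2 i] on the residues mod 23, since 12 is the inverse of 2. It preserves the
    quadratic residue code because 2 = 5^2 is a square mod 23. *)
Definition double_perm : seq nat :=
  [seq (12 * j) %% 23 | j <- iota 0 23]%N ++ [:: 23%N].

Lemma golay_size c : golay c -> size c = 24%N.
Proof. by case/andP => /eqP. Qed.

Lemma golay_xorw c d : golay c -> golay d -> golay (xorw c d).
Proof.
move=> /andP[/eqP sc /eqP dc] /andP[/eqP sd /eqP dd].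
apply/andP; split; first by rewrite size_xorw ?sc ?sd.
rewrite drop_xorw take_xorw dc dd xorw_map; apply/eqP/eq_map => row.
by rewrite parity_xorw // !size_take sc sd.
Qed.

Lemma mem_golay_words c : (c \in golay_words) = golay c.
Proof.
apply/mapP/andP => [[m + ->]|[/eqP sc /eqP dc]].
  rewrite mem_words => /eqP sm.
  by rewrite size_cat size_map sm take_size_cat // drop_size_cat.
exists (take 12 c); first by rewrite mem_words size_take sc.
by rewrite -dc cat_take_drop.
Qed.

Lemma golay_words_uniq : uniq golay_words.
Proof.
rewrite map_inj_in_uniq ?words_uniq // => c d.
rewrite !mem_words => /eqP sc /eqP sd /(congr1 (take 12)).
by rewrite !take_size_cat.
Qed.

Lemma size_golay_words : size golay_words = (2 ^ 12)%N.
Proof. by rewrite size_map size_words. Qed.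

(** One pass over the 4096 codewords verifies double evenness, minimum weight 8 and invariance under
    both permutations. *)
Lemma golay_check : all (fun c =>
  [&& (4 %| wt c)%N, (wt c == 0%N) || (8 <= wt c)%N,
      golay (coord_map false shift_perm c) &
      golay (coord_map false double_perm c)]) golay_words.
Proof. by vm_cast_no_check (erefl true). Qed.

Lemma size_octads : size octads = 759%N.
Proof. by vm_cast_no_check (erefl 759%N). Qed.

Lemma golay_ones : golay (nseq 24 true).
Proof. by vm_compute. Qed.

Lemma golay_wt_div4 c : golay c -> (4 %| wt c)%N.
Proof. by rewrite -mem_golay_words => /(allP golay_check)/and4P[]. Qed.

Lemma golay_wt_ge8 c : golay c -> wt c = 0%N \/ (8 <= wt c)%N.
Proof.
rewrite -mem_golay_words => /(allP golay_check)/and4P[_ /orP[/eqP|] ? _ _].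
  by left.
by right.
Qed.

Definition golay_perm (p : seq nat) : Prop :=
  perm_eq p (iota 0 24) /\
  forall c, golay c -> golay (coord_map false p c).

Lemma golay_shift : golay_perm shift_perm.
Proof.
split=> [|c]; first by vm_compute.
by rewrite -mem_golay_words => /(allP golay_check)/and4P[].
Qed.

Lemma golay_double : golay_perm double_perm.
Proof.
split=> [|c]; first by vm_compute.
by rewrite -mem_golay_words => /(allP golay_check)/and4P[].
Qed.

(** * The Leech lattice *)

(* The coordinates of [x] are [m + 2 c_i] modulo 4. *)
Inductive residues (m : Z) : bitseq -> seq Z -> Prop :=
| residues_nil : residues m [::] [::]
| residues_cons b c t x : residues m c x ->
    residues m (b :: c) (m + 2 * Z.b2z b + 4 * t :: x).

(* The lattice is scaled by the square root of 8 with respect to the even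
   unimodular normalization, hence has minimal norm 32. As the all-ones word is
   a codeword, [m] matters only modulo 2. *)
Definition leech (x : seq Z) : Prop := exists m c,
  [/\ golay c, residues m c x & exists t, zsum x = 4 * m + 8 * t].

Lemma residues_size m c x : residues m c x -> size x = size c.
Proof. by elim=> //= b d t y _ ->. Qed.

Lemma leech_size x : leech x -> size x = 24%N.
Proof. by case=> m [c [/golay_size <- /residues_size]]. Qed.

(** Modulo 4, the difference of [2 b] and [2 b'] is twice the exclusive or of the bits, so
    subtracting vectors adds codewords. *)
Lemma residues_vsub m m' c d x y : residues m c x -> residues m' d y ->
  residues (m - m') (xorw c d) (vsub x y).
Proof.
move=> rx; elim: rx d y => [|b e t z _ IH] d y ry /=; first exact: residues_nil.
case: ry => [|b' e' t' z' rz] /=; first exact: residues_nil.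
have [s ->] : exists s, m + 2 * Z.b2z b + 4 * t - (m' + 2 * Z.b2z b' + 4 * t')
    = m - m' + 2 * Z.b2z (b (+) b') + 4 * s.
  case: b b' => -[] /=; first [exists (t - t'); lia | exists (t - t' - 1); lia].
by apply: residues_cons; apply: IH.
Qed.

Lemma leech_vsub x y : leech x -> leech y -> leech (vsub x y).
Proof.
move=> lx ly; have sxy : size x = size y by rewrite !leech_size.
case: lx => m [c [gc rx [t zx]]]; case: ly => m' [d [gd ry [t' zy]]].
exists (m - m'), (xorw c d); split; first exact: golay_xorw.
  exact: residues_vsub.
by exists (t - t'); rewrite zsum_vsub // zx zy; lia.
Qed.

(** A shift of [m] by 2 flips every bit modulo 4, that is, adds the all-ones word. *)
Lemma residues_even m n c x :
  residues (m + 2 * n) c x -> residues m (xorw c (nseq (size c) (Z.odd n))) x.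
Proof.
elim=> [|b d t y _ IH] /=; first exact: residues_nil.
have [s ->] : exists s, m + 2 * n + 2 * Z.b2z b + 4 * t
    = m + 2 * Z.b2z (b (+) Z.odd n) + 4 * s.
  have := Zdiv2_odd_eqn n; rewrite -/(Z.b2z (Z.odd n)) => hn.
  case: b (Z.odd n) hn => -[] /= hn;
    first [exists (t + Z.div2 n); lia | exists (t + Z.div2 n + 1); lia].
by apply: residues_cons.
Qed.

Lemma leech_normal x : leech x -> exists m c,
  [/\ m = 0 \/ m = 1, golay c, residues m c x
    & exists t, zsum x = 4 * m + 8 * t].
Proof.
case=> m [c [gc rx [t zx]]].
have hm := Zdiv2_odd_eqn m; set r := if Z.odd m then 1 else 0 in hm.
exists r, (xorw c (nseq (size c) (Z.odd (Z.div2 m)))); split.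
- by rewrite /r; case: Z.odd; [right | left].
- apply: golay_xorw => //; rewrite (golay_size gc).
  by case: Z.odd; [exact: golay_ones | vm_compute].
- by apply: residues_even; rewrite Z.add_comm -hm.
- by exists (t + Z.div2 m); rewrite zx {1}hm; lia.
Qed.

(** On the support of [c] the entries are 2 modulo 4, and (2 + 4t)^2 = 4 + 16 t (t + 1). *)
Lemma residues0_norm c x : residues 0 c x -> 4 * Z.of_nat (wt c) <= dot x x.
Proof.
rewrite /wt; elim=> //= -[] d t y _ /= IH; last by nia.
have : 0 <= t * (t + 1) by nia.
lia.
Qed.

(** All entries are multiples 4 t_i. Here s is the sum of the t_i^2 and t that of the t_i; they have
    the same parity. A coordinate sum divisible by 8 then forces a norm divisible by 32. *)
Lemma residues0_zero c x : residues 0 c x -> wt c = 0%N ->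
  exists s t, [/\ dot x x = 16 * s, zsum x = 4 * t & Z.even (s - t)].
Proof.
elim=> [_|[] d t y _ IH] //=; first by exists 0, 0.
case/IH => s [u [h1 h2 h3]]; exists (t * t + s), (t + u); split; try lia.
have := Z.even_spec (t * (t - 1)); rewrite Z.even_mul Z.even_sub /= => ev.
have -> : t * t + s - (t + u) = t * (t - 1) + (s - u) by lia.
by rewrite Z.even_add h3 Z.even_mul Z.even_sub; case: (Z.even t).
Qed.

(** All entries are odd, and an odd square is 1 + 8u with u = 0 only for the entries 1 and -1, whose
    signs are then given by [c]. *)
Lemma residues1_norm c x : residues 1 c x -> exists s,
  [/\ dot x x = Z.of_nat (size x) + 8 * s, 0 <= s
    & s = 0 -> zsum x = Z.of_nat (size x) - 2 * Z.of_nat (wt c)].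
Proof.
elim=> [|b d t y _ [s [h1 h2 h3]]]; first by exists 0.
have [u [hu u0 uz]] : exists u,
    let a := 1 + 2 * Z.b2z b + 4 * t in
    [/\ a * a = 1 + 8 * u, 0 <= u & u = 0 -> a = 1 - 2 * Z.b2z b].
  have tP : t <= -1 \/ 0 <= t by lia.
  case: b => /=; [exists ((2 * t + 1) * (t + 1)) | exists (t * (2 * t + 1))].
    by split; first lia; case: tP; nia.
  by split; first lia; case: tP; nia.
exists (u + s); split; rewrite ?[size _]/= ?[dot _ _]/=; try lia.
by move=> us0; rewrite [zsum _]/= h3 ?uz /wt /=; case: (b) => /=; lia.
Qed.

(** Even vectors: a nonzero codeword has weight at least 8, giving norm at least 4 * 8, and the zero
    codeword gives a multiple of 32. Odd vectors: the norm is 24 + 8s, and s = 0 would make the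
    coordinate sum 24 - 2 wt, a multiple of 8, although it must be 4 modulo 8. *)
Lemma leech_norm x : leech x -> dot x x = 0 \/ 32 <= dot x x.
Proof.
move=> lx; have sx := leech_size lx.
have [m [c [[->|->] gc rx [t zx]]]] := leech_normal lx.
  have [w0|w8] := golay_wt_ge8 gc; last first.
    by right; have := residues0_norm rx; lia.
  have [s [u [h1 h2 /Z.even_spec [v hv]]]] := residues0_zero rx w0.
  have := @dot_ge0 x; lia.
have [s [h1 h2 h3]] := residues1_norm rx; rewrite sx in h1 h3.
have /dvdnP[k hk] := golay_wt_div4 gc.
right; case: (Z.eq_dec s 0) => [/h3|]; lia.
Qed.

Definition leech_min (x : seq Z) : Prop := leech x /\ dot x x = 32.

(** The difference is a nonzero lattice vector of norm 64 - 2 <x, y>, which is at least 32. *)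
Lemma leech_min_dot x y : leech_min x -> leech_min y -> x <> y -> dot x y <= 16.
Proof.
move=> [lx nx] [ly ny] xy.
have sxy : size x = size y by rewrite !leech_size.
have := dot_vsub sxy.
by have [/(vsub_eq0 sxy)//|] := leech_norm (leech_vsub lx ly); lia.
Qed.

Lemma residues_nth m c x i : residues m c x -> (i < size c)%N ->
  exists t, nth 0 x i = m + 2 * Z.b2z (nth false c i) + 4 * t.
Proof.
move=> rx; elim: rx i => [//|b d t y _ IH] [_|i /IH //].
by exists t.
Qed.

Lemma residues_coord_map m c x p : residues m c x ->
  all (fun i => i < size c)%N p ->
  residues m (coord_map false p c) (coord_map 0 p x).
Proof.
move=> rx; elim: p => [_|i p IH] /=; first exact: residues_nil.
case/andP => /(residues_nth rx)[t ->] /IH; exact: residues_cons.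
Qed.

(** Automorphisms of the Golay code act on the lattice: residues move along with the codeword, while
    norm and coordinate sum are unchanged. *)
Lemma leech_min_coord_map p x :
  golay_perm p -> leech_min x -> leech_min (coord_map 0 p x).
Proof.
move=> [pn gp] [lx nx]; have sx := leech_size lx.
split; last by rewrite (dot_coord_map pn).
case: lx => m [c [gc rx [t zx]]]; exists m, (coord_map false p c); split.
- exact: gp.
- apply: residues_coord_map => //; apply/allP => i.
  by rewrite (perm_mem pn) mem_iota (golay_size gc).
- by exists t; rewrite (zsum_coord_map pn).
Qed.

(** * Minimal vectors of the Leech lattice *)

Lemma residues_inj m c d x : residues m c x -> residues m d x -> c = d.
Proof.
move=> rc rd; have scd : size c = size d.
  by rewrite -(residues_size rc) (residues_size rd).
apply: (@eq_from_nth _ false) => // i ic.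
have [t ht] := residues_nth rc ic; rewrite scd in ic.
have [u hu] := residues_nth rd ic; move: ht; rewrite hu.
by case: (nth false c i); case: (nth false d i) => //=; lia.
Qed.

Lemma residues01 c d x : residues 0 c x -> residues 1 d x -> x = [::].
Proof.
move=> rc rd; case: x => [//|a x] in rc rd *.
have c0 : (0 < size c)%N by rewrite -(residues_size rc).
have d0 : (0 < size d)%N by rewrite -(residues_size rd).
have [t ht] := residues_nth rc c0; have [u hu] := residues_nth rd d0.
move: ht; rewrite hu.
by case: (nth false c 0); case: (nth false d 0) => //=; lia.
Qed.

Definition signs (v : Z) (w : bitseq) : seq Z :=
  [seq if b then - v else v | b <- w].

(* Puts the entries of [s] on the support of [o]. *)
Fixpoint spread (o : bitseq) (s : seq Z) : seq Z :=
  if o is b :: o' then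
    if b then head 0 s :: spread o' (behead s) else 0 :: spread o' s
  else [::].

Lemma size_signs v w : size (signs v w) = size w.
Proof. exact: size_map. Qed.

Lemma dot_signs v w : dot (signs v w) (signs v w) = v * v * Z.of_nat (size w).
Proof. elim: w => [|[] w /= ->] /=; lia. Qed.

Lemma zsum_signs v w :
  zsum (signs v w) = v * (Z.of_nat (size w) - 2 * Z.of_nat (wt w)).
Proof. rewrite /wt; elim: w => [|[] w /= ->] /=; lia. Qed.

Lemma signs_inj v : v <> 0 -> injective (signs v).
Proof. by move=> v0; apply: inj_map => -[] []; lia. Qed.

Lemma signs_neq0 v w : v <> 0 -> all (fun z => z != 0) (signs v w).
Proof. by move=> v0; apply/allP => z /mapP[[] _ ->]; apply/eqP; lia. Qed.

Lemma spread_filter o s : size s = wt o -> all (fun z => z != 0) s ->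
  [seq z <- spread o s | z != 0] = s.
Proof.
rewrite /wt; elim: o s => [|[] o IH] [|a s] //=.
- by move=> [so] /andP[-> /(IH _ so) ->].
- by move=> so _; rewrite (IH [::]).
- by move=> so /(IH (a :: s) so) /= ->.
Qed.

Lemma spread_support o s : size s = wt o -> all (fun z => z != 0) s ->
  [seq z != 0 | z <- spread o s] = o.
Proof.
rewrite /wt; elim: o s => [|[] o IH] [|a s] //=.
- by move=> [so] /andP[-> /(IH _ so) ->].
- by move=> so _; rewrite (IH [::]).
- by move=> so /(IH (a :: s) so) /= ->.
Qed.

Lemma dot_spread o s :
  size s = wt o -> dot (spread o s) (spread o s) = dot s s.
Proof.
rewrite /wt; elim: o s => [|[] o IH] [|a s] //=.
- by move=> [/IH ->].
- by move=> so; rewrite (IH [::]).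
- by move=> so; rewrite (IH (a :: s)).
Qed.

Lemma zsum_spread o s : size s = wt o -> zsum (spread o s) = zsum s.
Proof.
rewrite /wt; elim: o s => [|[] o IH] [|a s] //=.
- by move=> [/IH ->].
- by move=> so; rewrite (IH [::]).
- by move=> so; rewrite (IH (a :: s)).
Qed.

(** The support of the vector recovers [o], and its nonzero entries in order recover the signs
    [w]. *)
Lemma spread_signs_inj v o w o' w' : v <> 0 ->
  size w = wt o -> size w' = wt o' ->
  spread o (signs v w) = spread o' (signs v w') -> (o, w) = (o', w').
Proof.
move=> v0 sw sw' e.
have z u : all (fun z => z != 0) (signs v u) by apply: signs_neq0.
have ss : size (signs v w) = wt o by rewrite size_signs.
have ss' : size (signs v w') = wt o' by rewrite size_signs.
congr pair; first by rewrite -(spread_support ss) // -(spread_support ss') // e.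
apply: (signs_inj v0).
by rewrite -(spread_filter ss) // -(spread_filter ss') // e.
Qed.

Lemma residues_spread2 o w :
  size w = wt o -> residues 0 o (spread o (signs 2 w)).
Proof.
rewrite /wt; elim: o w => [|[] o IH] w /= sw; first exact: residues_nil.
  case: w sw => //= b w [/IH rw].
  have -> : (if b then - (2) else 2) = 0 + 2 * Z.b2z true + 4 * (- Z.b2z b).
    by case: b.
  exact: residues_cons.
by apply: (@residues_cons 0 false _ 0); apply: IH.
Qed.

Lemma residues_spread4 o w : size w = wt o ->
  residues 0 (nseq (size o) false) (spread o (signs 4 w)).
Proof.
rewrite /wt; elim: o w => [|[] o IH] w /= sw; first exact: residues_nil.
  case: w sw => //= b w [/IH rw].
  have -> : (if b then - (4) else 4) =
      0 + 2 * Z.b2z false + 4 * (1 - 2 * Z.b2z b).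
    by case: b.
  exact: residues_cons.
by apply: (@residues_cons 0 false _ 0); apply: IH.
Qed.

(** For [i] in range, the vector with -3 at place [i] and 1 elsewhere, with signs changed on the
    support of [c]. *)
Fixpoint odd_vector (c : bitseq) (i : nat) : seq Z :=
  if c is b :: c' then
    if i is i'.+1 then (if b then -1 else 1) :: odd_vector c' i'
    else (if b then 3 else -3) :: signs 1 c'
  else [::].

Lemma residues_signs1 c : residues 1 c (signs 1 c).
Proof.
elim: c => [|b c IH] /=; first exact: residues_nil.
have -> : (if b then -1 else 1) = 1 + 2 * Z.b2z b + 4 * (- Z.b2z b) by case: b.
exact: residues_cons.
Qed.

Lemma residues_odd_vector c i : residues 1 c (odd_vector c i).
Proof.
elim: c i => [|b c IH] [|i] /=; try exact: residues_nil.
  have -> : (if b then 3 else -3) = 1 + 2 * Z.b2z b + 4 * (Z.b2z b - 1).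
    by case: b.
  by apply: residues_cons; apply: residues_signs1.
have -> : (if b then -1 else 1) = 1 + 2 * Z.b2z b + 4 * (- Z.b2z b) by case: b.
exact: residues_cons.
Qed.

Lemma dot_odd_vector c i : (i < size c)%N ->
  dot (odd_vector c i) (odd_vector c i) = Z.of_nat (size c) + 8.
Proof.
elim: c i => [|b c IH] [|i] //= ic; first by rewrite dot_signs; case: b; lia.
by rewrite IH //; case: b; lia.
Qed.

(** Compared with [signs 1 c], one entry 1 becomes -3 or one entry -1 becomes 3; either change is 4
    modulo 8. *)
Lemma zsum_odd_vector c i : (i < size c)%N -> exists t,
  zsum (odd_vector c i) =
    Z.of_nat (size c) - 2 * Z.of_nat (wt c) + 4 + 8 * t.
Proof.
rewrite /wt; elim: c i => [|b c IH] [|i] //= ic.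
  rewrite -/(zsum _) zsum_signs /wt; exists (Z.b2z b - 1).
  by case: b => /=; lia.
by have [t] := IH _ ic; rewrite /zsum => ->; exists t; case: b => /=; lia.
Qed.

Lemma find_odd_vector c i : (i < size c)%N ->
  find (fun z => Z.abs z == 3) (odd_vector c i) = i.
Proof.
elim: c i => [|b c IH] [|i] //= ic; first by case: b.
by rewrite IH //; case: b.
Qed.

(** Direct recursion on the weight avoids filtering all 2^24 words of length 24. *)
Fixpoint words_of_weight n k : seq bitseq :=
  if n is n'.+1 then
    map (cons false) (words_of_weight n' k) ++
    (if k is k'.+1 then map (cons true) (words_of_weight n' k') else [::])
  else if k is 0%N then [:: [::]] else [::].

Definition pair_words : seq bitseq := words_of_weight 24 2.

Definition even_words : seq bitseq := [seq w <- words 8 | ~~ odd (wt w)].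

(** The classical shapes of minimal vectors: 276 * 4 with two entries of absolute value 4, 759 * 128
    with entries of absolute value 2 on an octad and evenly many minus signs, and 4096 * 24 with one
    entry of absolute value 3 and the others odd units. *)
Definition shape4 : seq (seq Z) :=
  [seq spread o (signs 4 w) | o <- pair_words, w <- words 2].
Definition shape2 : seq (seq Z) :=
  [seq spread o (signs 2 w) | o <- octads, w <- even_words].
Definition shape3 : seq (seq Z) :=
  [seq odd_vector c i | c <- golay_words, i <- iota 0 24].

Definition leech_vectors : seq (seq Z) := shape4 ++ shape2 ++ shape3.

Lemma pair_words_check :
  [&& uniq pair_words, size pair_words == 276%N &
      all (fun c => (size c == 24%N) && (wt c == 2%N)) pair_words].
Proof. by vm_cast_no_check (erefl true). Qed.

Lemma pair_wordsP o : o \in pair_words -> size o = 24%N /\ wt o = 2%N.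
Proof.
by case/and3P: pair_words_check => _ _ /allP ho /ho/andP[/eqP ? /eqP].
Qed.

Lemma octadsP o : o \in octads -> golay o /\ wt o = 8%N.
Proof. by rewrite mem_filter mem_golay_words => /andP[/eqP]. Qed.

Lemma even_wordsP w : w \in even_words -> size w = 8%N /\ ~~ odd (wt w).
Proof. by rewrite mem_filter mem_words => /andP[? /eqP]. Qed.

Lemma size_even_words : size even_words = 128%N.
Proof. by vm_compute. Qed.

Lemma leech_min_shape4 x : x \in shape4 ->
  leech_min x /\ residues 0 (nseq 24 false) x.
Proof.
case/allpairsP=> -[o w] [/pair_wordsP[so wo]].
rewrite mem_words => /eqP /= sw ->.
have rx := @residues_spread4 o w; rewrite sw wo so in rx.
split; last exact: rx.
have ss : size (signs 4 w) = wt o by rewrite size_signs sw wo.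
split; last by rewrite dot_spread // dot_signs sw.
exists 0, (nseq 24 false); split; [by vm_compute | exact: rx |].
exists (1 - Z.of_nat (wt w)).
by rewrite zsum_spread // zsum_signs sw; lia.
Qed.

Lemma leech_min_shape2 x : x \in shape2 ->
  leech_min x /\ exists2 o, wt o = 8%N & residues 0 o x.
Proof.
case/allpairsP=> -[o w] [/octadsP[go wo] /even_wordsP[sw ew] ->].
have rx : residues 0 o (spread o (signs 2 w)).
  by apply: residues_spread2; rewrite sw wo.
have ss : size (signs 2 w) = wt o by rewrite size_signs sw wo.
split; last by exists o.
split; last by rewrite dot_spread // dot_signs sw.
exists 0, o; split=> //.
(* The sum is 2 (8 - 2 wt), a multiple of 8 because the number of minus signs is even. *)
exists (2 - Z.of_nat (wt w)./2); rewrite zsum_spread // zsum_signs sw.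
by rewrite -[in LHS](odd_double_half (wt w)) (negbTE ew); lia.
Qed.

Lemma leech_min_shape3 x : x \in shape3 ->
  leech_min x /\ exists c, residues 1 c x.
Proof.
case/allpairsP=> -[c i] []; rewrite mem_golay_words mem_iota.
move=> /= gc i24 ->.
have sc := golay_size gc; rewrite add0n -sc in i24.
have rx := residues_odd_vector c i.
split; last by exists c.
split; last by rewrite dot_odd_vector // sc.
exists 1, c; split=> //.
have /dvdnP[k hk] := golay_wt_div4 gc.
have [t ->] := zsum_odd_vector i24; exists (t + 3 - Z.of_nat k).
by rewrite sc hk; lia.
Qed.

Lemma leech_vectors_min x : x \in leech_vectors -> leech_min x.
Proof.
rewrite /leech_vectors mem_cat => /orP[/leech_min_shape4[]//|].
by rewrite mem_cat => /orP[/leech_min_shape2[]|/leech_min_shape3[]].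
Qed.

Lemma shape4_uniq : uniq shape4.
Proof.
apply: allpairs_uniq; [by case/and3P: pair_words_check | exact: words_uniq |].
move=> p q /allpairsP[[o w] [/pair_wordsP[_ wo] + ->]].
move=> + /allpairsP[[o' w'] [/pair_wordsP[_ wo'] + ->]].
rewrite !mem_words => /eqP sw /eqP sw'.
by apply: spread_signs_inj; rewrite ?wo ?wo'.
Qed.

Lemma shape2_uniq : uniq shape2.
Proof.
apply: allpairs_uniq; first exact/filter_uniq/golay_words_uniq.
  exact/filter_uniq/words_uniq.
move=> p q /allpairsP[[o w] [/octadsP[_ wo] /even_wordsP[sw _] ->]].
move=> /allpairsP[[o' w'] [/octadsP[_ wo'] /even_wordsP[sw' _] ->]].
by apply: spread_signs_inj; rewrite ?wo ?wo'.
Qed.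

Lemma shape3_uniq : uniq shape3.
Proof.
apply: allpairs_uniq; [exact: golay_words_uniq | exact: iota_uniq |].
move=> p q /allpairsP[[c i] [+ + ->]] /allpairsP[[d j] [+ + ->]].
rewrite !mem_golay_words !mem_iota /= => gc ic gd jd e.
have cd : c = d.
  apply: residues_inj (residues_odd_vector c i) _.
  by rewrite e; apply: residues_odd_vector.
congr pair => //; rewrite -(@find_odd_vector c i) ?golay_size //.
by rewrite e find_odd_vector // golay_size.
Qed.

(** Residues modulo 4 separate the shapes: even entries with the zero word, even entries with an
    octad, odd entries. *)
Lemma leech_vectors_uniq : uniq leech_vectors.
Proof.
have x0 x : leech_min x -> x <> [::].
  by case=> /leech_size sx _ xnil; rewrite xnil in sx.
have disj23 x : x \in shape2 -> x \in shape3 -> False.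
  move=> /leech_min_shape2[mx [o _ r0]] /leech_min_shape3[_ [c r1]].
  exact: x0 mx (residues01 r0 r1).
have disj4 x : x \in shape4 -> x \in shape2 ++ shape3 -> False.
  move=> /leech_min_shape4[mx r0]; rewrite mem_cat.
  case/orP=> [/leech_min_shape2[_ [o wo r0']]|/leech_min_shape3[_ [c r1]]].
    by move: wo; rewrite -(residues_inj r0 r0').
  exact: x0 mx (residues01 r0 r1).
rewrite /leech_vectors cat_uniq; apply/and3P; split; first exact: shape4_uniq.
  by apply/hasPn => x hx; apply/negP => /disj4; apply.
rewrite cat_uniq; apply/and3P; split.
- exact: shape2_uniq.
- by apply/hasPn => x hx; apply/negP => /disj23; apply.
- exact: shape3_uniq.
Qed.

Lemma size_leech_vectors : size leech_vectors = nat_of_bin 196560%num.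
Proof.
have /and3P[_ /eqP sp _] := pair_words_check.
have size_cat3 (a b c : seq (seq Z)) :
  size (a ++ b ++ c) = (size a + (size b + size c))%N by rewrite !size_cat.
rewrite size_cat3.
have -> : size shape4 = (276 * 2 ^ 2)%N by rewrite size_allpairs sp size_words.
have -> : size shape2 = (759 * 128)%N.
  by rewrite size_allpairs size_octads size_even_words.
have -> : size shape3 = (2 ^ 12 * 24)%N.
  by rewrite size_allpairs size_golay_words size_iota.
lia.
Qed.

(** * Disjoint sets of minimal vectors with inner products at most 8 *)

(* Each vector is a number whose 24 hexadecimal digits are its coordinates in
   two's complement, so [e] is -2 and [c] is -4. The set was found by computer,
   as a union of orbits of a monomial automorphism of order 6. *)
Definition sparse_codes : seq BinNums.N := [::
    0x0000000000004000000c0000; 0x000000000000c00000040000;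
    0x000000000004000000000004; 0x00000000000c000000000004;
    0x000000004000040000000000; 0x0000000040000c0000000000;
    0x00000000e2e20e2020000e00; 0x00000000e2ee02e0e0000e00;
    0x00000000ee220e20e0000200; 0x00000000ee2e02e020000200;
    0x00000004c000000000000000; 0x0000000cc000000000000000;
    0x000000220000020ee0e020e0; 0x0000002200000e0e20202020;
    0x000000222e0ee020000e0000; 0x0000002e000002022020e020;
    0x0000002e00000e02e0e0e0e0; 0x0000002e220e202000020000;
    0x000000e20000020220e0e0e0; 0x000000e200000e02e020e020;
    0x000000e2220220e000020000; 0x000000ee0000020ee0202020;
    0x000000ee00000e0e20e020e0; 0x000000ee2e02e0e0000e0000;
    0x00000200200000000202eeee; 0x0000020020000000020e222e;
    0x00000200200000000e0222e2; 0x00000200200000000e0eee22;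
    0x000002002020200e02e00002; 0x000002002020e0020ee0000e;
    0x0000020020e0200e0e20000e; 0x0000020020e0e00202200002;
    0x00000200e00000000202e222; 0x00000200e0000000020e2ee2;
    0x00000200e00000000e022e2e; 0x00000200e00000000e0ee2ee;
    0x00000200e02020020e200002; 0x00000200e020e00e0220000e;
    0x00000200e0e0200202e0000e; 0x00000200e0e0e00e0ee00002;
    0x00000e002000000002022e22; 0x00000e0020000000020ee2e2;
    0x00000e00200000000e02e22e; 0x00000e00200000000e0e2eee;
    0x00000e00202020020220000e; 0x00000e002020e00e0e200002;
    0x00000e0020e020020ee00002; 0x00000e0020e0e00e02e0000e;
    0x00000e00e0000000020222ee; 0x00000e00e0000000020eee2e;
    0x00000e00e00000000e02eee2; 0x00000e00e00000000e0e2222;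
    0x00000e00e020200e0ee0000e; 0x00000e00e020e00202e00002;
    0x00000e00e0e0200e02200002; 0x00000e00e0e0e0020e20000e;
    0x00002000020020020200ee02; 0x00002000020020020e00220e;
    0x000020000200e00e02002202; 0x000020000200e00e0e00ee0e;
    0x000020000220000002ee00ee; 0x00002000022000000ee20022;
    0x0000200002e000000222002e; 0x0000200002e000000e2e00e2;
    0x000020000e00200e0200e20e; 0x000020000e00200e0e002e02;
    0x000020000e00e00202002e0e; 0x000020000e00e0020e00e202;
    0x000020000e200000022200e2; 0x000020000e2000000e2e002e;
    0x000020000ee0000002ee0022; 0x000020000ee000000ee200ee;
    0x000040000000004000000000; 0x00004000000000c000000000;
    0x0000e0000200200e02002e0e; 0x0000e0000200200e0e00e202;
    0x0000e0000200e0020200e20e; 0x0000e0000200e0020e002e02;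
    0x0000e00002200000022e0022; 0x0000e000022000000e2200ee;
    0x0000e00002e0000002e200e2; 0x0000e00002e000000eee002e;
    0x0000e0000e00200202002202; 0x0000e0000e0020020e00ee0e;
    0x0000e0000e00e00e0200ee02; 0x0000e0000e00e00e0e00220e;
    0x0000e0000e20000002e2002e; 0x0000e0000e2000000eee00e2;
    0x0000e0000ee00000022e00ee; 0x0000e0000ee000000e220022;
    0x0000e200000202e020202000; 0x0000e200000e0e20e0202000;
    0x0000e222000e00e2000000e0; 0x0000e2ee00020022000000e0;
    0x0000ee00000202e0e0e0e000; 0x0000ee00000e0e2020e0e000;
    0x0000ee2e000e00ee00000020; 0x0000eee20002002e00000020;
    0x00020002002e0e0e000002e0; 0x0002000200e2020200000e20;
    0x0002000222000022e00000e0; 0x000200022e0000eee0000020;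
    0x0002000e00220e0e00000e20; 0x0002000e00ee0202000002e0;
    0x0002002000e20000e0202200; 0x0002002000ee000020e02e00;
    0x00020020e2000ee00020e000; 0x000200e0002200002020e200;
    0x000200e0002e0000e0e0ee00; 0x000200e0ee00022000e02000;
    0x00022220ee0e0000e0000000; 0x00022ee0e2020000e0000000;
    0x0002e20e000020e0e0020000; 0x0002e2200020022000000e00;
    0x0002e2e02e0e000020000000; 0x0002ee0e0000e020e00e0000;
    0x0002ee202202000020000000; 0x0002eee000e00ee000000200;
    0x00040000000000000000000c; 0x000c0000000000000000000c;
    0x000e0002002e020e00000e20; 0x000e000200e20e02000002e0;
    0x000e000e0022020e000002e0; 0x000e000e00ee0e0200000e20;
    0x000e000e220000e2200000e0; 0x000e000e2e00002e20000020;
    0x000e00200022000020e0ee00; 0x000e0020002e0000e020e200;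
    0x000e0020ee000ee000e02000; 0x000e00e000e20000e0e02e00;
    0x000e00e000ee000020202200; 0x000e00e0e20002200020e000;
    0x000e22e0ee02000020000000; 0x000e2e20e20e000020000000;
    0x000ee2020000202020020000; 0x000ee2202e020000e0000000;
    0x000ee2e000200ee000000e00; 0x000eee020000e0e0200e0000;
    0x000eee2000e0022000000200; 0x000eeee0220e0000e0000000;
    0x0020000000020eeee00000ee; 0x00200000000e022e200000ee;
    0x00200022000200200020e00e; 0x002000ee000e00e00020e00e;
    0x00200200020020000ee00ee0; 0x002002000200e0000e200220;
    0x002002000220000202022000; 0x0020020002e0000e020ee000;
    0x002002000e00200002200e20; 0x002002000e00e00002e002e0;
    0x002002000e20000e0e02e000; 0x002002000ee000020e0e2000;
    0x00200e000200200002e00220; 0x00200e000200e00002200ee0;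
    0x00200e00022000020e0ee000; 0x00200e0002e0000e0e022000;
    0x00200e000e0020000e2002e0; 0x00200e000e00e0000ee00e20;
    0x00200e000e20000e020e2000; 0x00200e000ee000020202e000;
    0x00202000200000020e220e00; 0x002020002000000e0eee0200;
    0x002020002020e0000200e020; 0x0020200020e02000020020e0;
    0x00202000e0000002022e0200; 0x00202000e000000e02e20e00;
    0x00202000e020e0000e0020e0; 0x00202000e0e020000e00e020;
    0x00202e2e00000200e000000e; 0x00202ee200000e002000000e;
    0x0020e0002000000202ee0e00; 0x0020e0002000000e02220200;
    0x0020e000202020000e002020; 0x0020e00020e0e0000e00e0e0;
    0x0020e000e00000020ee20200; 0x0020e000e000000e0e2e0e00;
    0x0020e000e02020000200e0e0; 0x0020e000e0e0e00002002020;
    0x0020ee2200000e00e0000002; 0x0020eeee0000020020000002;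
    0x00220002002000e020000e02; 0x002200e000002e2000020002;
    0x002e000e00200020e0000e02; 0x002e0020000022e000020002;
    0x00e0000000020ee22000002e; 0x00e00000000e0222e000002e;
    0x00e0002e0002002000e0200e; 0x00e000e2000e00e000e0200e;
    0x00e0020002002000022002e0; 0x00e002000200e00002e00e20;
    0x00e002000220000e0e0e2000; 0x00e0020002e000020e02e000;
    0x00e002000e0020000ee00220; 0x00e002000e00e0000e200ee0;
    0x00e002000e200002020ee000; 0x00e002000ee0000e02022000;
    0x00e00e00020020000e200e20; 0x00e00e000200e0000ee002e0;
    0x00e00e000220000e0202e000; 0x00e00e0002e00002020e2000;
    0x00e00e000e00200002e00ee0; 0x00e00e000e00e00002200220;
    0x00e00e000e2000020e022000; 0x00e00e000ee0000e0e0ee000;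
    0x00e020002000000202e20200; 0x00e020002000000e022e0e00;
    0x00e02000202020000e00e0e0; 0x00e0200020e0e0000e002020;
    0x00e02000e00000020eee0e00; 0x00e02000e000000e0e220200;
    0x00e02000e020200002002020; 0x00e02000e0e0e0000200e0e0;
    0x00e02222000002002000000e; 0x00e022ee00000e00e000000e;
    0x00e0e000200000020e2e0200; 0x00e0e0002000000e0ee20e00;
    0x00e0e0002020e000020020e0; 0x00e0e00020e020000200e020;
    0x00e0e000e000000202220e00; 0x00e0e000e000000e02ee0200;
    0x00e0e000e020e0000e00e020; 0x00e0e000e0e020000e0020e0;
    0x00e0e22e00000e0020000002; 0x00e0e2e200000200e0000002;
    0x00e2000200e0002020000202; 0x00e200200000e2e0000e0002;
    0x00ee000e00e000e0e0000202; 0x00ee00e00000ee20000e0002;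
    0x02000022002200e00e000200; 0x0200002e00e200e002000e00;
    0x020000e200ee002002000e00; 0x020000ee002e00200e000200;
    0x020002000200000200ee0202; 0x020002000200000e00220e02;
    0x02000200022020000000e02e; 0x0200020002e0e000000020ee;
    0x020002000e0000020022020e; 0x020002000e00000e00ee0e0e;
    0x020002000e20e00000002022; 0x020002000ee020000000e0e2;
    0x02000e000200000200e20e0e; 0x02000e000200000e002e020e;
    0x02000e0002202000000020e2; 0x02000e0002e0e0000000e022;
    0x02000e000e000002002e0e02; 0x02000e000e00000e00e20202;
    0x02000e000e20e0000000e0ee; 0x02000e000ee020000000202e;
    0x020020002000200000200222; 0x020020002000e00000e00ee2;
    0x020020002020000e0002200e; 0x0200200020e00002000ee00e;
    0x02002000e000200000200eee; 0x02002000e000e00000e0022e;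
    0x02002000e020000e000ee002; 0x02002000e0e0000200022002;
    0x0200e0002000200000e002ee; 0x0200e0002000e00000200e2e;
    0x0200e000202000020002e002; 0x0200e00020e0000e000e2002;
    0x0200e000e000200000e00e22; 0x0200e000e000e000002002e2;
    0x0200e000e0200002000e200e; 0x0200e000e0e0000e0002e00e;
    0x0202002000000e220e000020; 0x020200e0000002ee020000e0;
    0x0202220e000202000e000000; 0x02022e0e000e0e0002000000;
    0x020e002000000e2e020000e0; 0x020e00e0000002e20e000020;
    0x020e2202000e0e000e000000; 0x020e2e020002020002000000;
    0x0220020020200000002e00e0; 0x0220020020e0000000e20020;
    0x02200200e000200e00002200; 0x02200200e000e0020000ee00;
    0x02200e002000200e0000ee00; 0x02200e002000e00200002200;
    0x02200e00e020000000220020; 0x02200e00e0e0000000ee00e0;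
    0x02202000020000000002e2e0; 0x0220200002000000000e2e20;
    0x022020000e20200200e00000; 0x022020000ee0e00e00200000;
    0x0220e0000220e00e00e00000; 0x0220e00002e0200200200000;
    0x0220e0000e00000000022ee0; 0x0220e0000e000000000ee220;
    0x02e002002000200200002e00; 0x02e002002000e00e0000e200;
    0x02e00200e020000000e200e0; 0x02e00200e0e00000002e0020;
    0x02e00e002020000000ee0020; 0x02e00e0020e00000002200e0;
    0x02e00e00e00020020000e200; 0x02e00e00e000e00e00002e00;
    0x02e020000220e00200200000; 0x02e0200002e0200e00e00000;
    0x02e020000e0000000002ee20; 0x02e020000e000000000e22e0;
    0x02e0e0000200000000022220; 0x02e0e00002000000000eeee0;
    0x02e0e0000e20200e00200000; 0x02e0e0000ee0e00200e00000;
    0x040000000000000040000000; 0x0400000000000000c0000000;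
    0x0c0000400000000000000000; 0x0c0000c00000000000000000;
    0x0e00000000022220e2020000; 0x0e0000000002e2202e0e0000;
    0x0e000000000e2ee022020000; 0x0e000000000eeee0ee0e0000;
    0x0e00020002000002002e0e0e; 0x0e0002000200000e00e2020e;
    0x0e0002000220e0000000e0e2; 0x0e00020002e0200000002022;
    0x0e0002000e00000200e20e02; 0x0e0002000e00000e002e0202;
    0x0e0002000e202000000020ee; 0x0e0002000ee0e0000000e02e;
    0x0e000e000200000200220202; 0x0e000e000200000e00ee0e02;
    0x0e000e000220e0000000202e; 0x0e000e0002e020000000e0ee;
    0x0e000e000e00000200ee020e; 0x0e000e000e00000e00220e0e;
    0x0e000e000e2020000000e022; 0x0e000e000ee0e000000020e2;
    0x0e0020002000200000e00e2e; 0x0e0020002000e000002002ee;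
    0x0e00200020200002000e2002; 0x0e00200020e0000e0002e002;
    0x0e002000e000200000e002e2; 0x0e002000e000e00000200e22;
    0x0e002000e02000020002e00e; 0x0e002000e0e0000e000e200e;
    0x0e00e0002000200000200ee2; 0x0e00e0002000e00000e00222;
    0x0e00e0002020000e000ee00e; 0x0e00e00020e000020002200e;
    0x0e00e000e00020000020022e; 0x0e00e000e000e00000e00eee;
    0x0e00e000e020000e00022002; 0x0e00e000e0e00002000ee002;
    0x0e02000e0000002022202000; 0x0e02000e000000e02ee0e000;
    0x0e02e20200020e000e000000; 0x0e02ee02000e020002000000;
    0x0e0e000200000020eee0e000; 0x0e0e0002000000e0e2202000;
    0x0e0ee20e000e02000e000000; 0x0e0eee0e00020e0002000000;
    0x0e200200200020020000e200; 0x0e2002002000e00e00002e00;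
    0x0e200200e020000000ee0020; 0x0e200200e0e00000002200e0;
    0x0e200e002020000000e200e0; 0x0e200e0020e00000002e0020;
    0x0e200e00e000200200002e00; 0x0e200e00e000e00e0000e200;
    0x0e2020000220200e00200000; 0x0e20200002e0e00200e00000;
    0x0e2020000e00000000022220; 0x0e2020000e000000000eeee0;
    0x0e20e000020000000002ee20; 0x0e20e00002000000000e22e0;
    0x0e20e0000e20e00200200000; 0x0e20e0000ee0200e00e00000;
    0x0ee002002020000000220020; 0x0ee0020020e0000000ee00e0;
    0x0ee00200e000200e0000ee00; 0x0ee00200e000e00200002200;
    0x0ee00e002000200e00002200; 0x0ee00e002000e0020000ee00;
    0x0ee00e00e0200000002e00e0; 0x0ee00e00e0e0000000e20020;
    0x0ee020000200000000022ee0; 0x0ee0200002000000000ee220;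
    0x0ee020000e20e00e00e00000; 0x0ee020000ee0200200200000;
    0x0ee0e0000220200200e00000; 0x0ee0e00002e0e00e00200000;
    0x0ee0e0000e0000000002e2e0; 0x0ee0e0000e000000000e2e20;
    0x200000020020022000202200; 0x2000000200e00ee000e0ee00;
    0x20000002220e00002020e000; 0x200000022e02000020e02000;
    0x2000000e002002e000e02e00; 0x2000000e00e00e200020e200;
    0x2000002000e0002ee0000e20; 0x2000002000e000ee200002e0;
    0x20000020e2020202000000e0; 0x200000e00020002220000e20;
    0x200000e0002000e2e00002e0; 0x200000e0ee0e0e0e00000020;
    0x2000220200220000e0000e00; 0x200022e0000e220000020000;
    0x20002e0200ee0000e0000200; 0x20002e200002ee00000e0000;
    0x200200000002002e00e0e0e0; 0x20020000000e00e200202020;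
    0x2002002e2e20000000000200; 0x200200ee22e0000000000e00;
    0x2002220000000e02200000e0; 0x20022e000000020e20000020;
    0x200e0000000200ee0020e020; 0x200e0000000e002200e020e0;
    0x200e0000e2002e00e0020000; 0x200e0000ee00e200e00e0000;
    0x200e222e0000000000202000; 0x200e2eee0000000000e0e000;
    0x2020000e000220002002000e; 0x20200020002e0e0000000e0e;
    0x20200020ee00002020000002; 0x202000e02e000020e000000e;
    0x2022000000000200e020e002; 0x202e00e20000000e000000e2;
    0x20e0000e000ee000200e000e; 0x20e00020220000e0e000000e;
    0x20e000e000e202000000020e; 0x20e000e0e20000e020000002;
    0x20e2000000000e00e0e02002; 0x20ee00220000000200000022;
    0x22000020000e02000ee0e000; 0x220000e000020e0002202000;
    0x220200220000200002020000; 0x220200e20000e0000e0e0000;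
    0x220e0000220200200e000000; 0x220e00002e0e00e002000000;
    0x2220000e00000ee00e000002; 0x22e0000e0000022002000002;
    0x2e00000e00020002ee000020; 0x2e00000e000e000ee20000e0;
    0x2e020000e20e00200e000000; 0x2e020000ee0200e002000000;
    0x2e0e000000200e002e000200; 0x2e0e000000e0020022000e00;
    0x2e200002000002e00e00000e; 0x2ee0000200000e200200000e;
    0x4000c0000000000000000000; 0xc000c0000000000000000000;
    0xe000000200200e2000e02e00; 0xe000000200e002e00020e200;
    0xe000000e00200ee000202200; 0xe000000e00e0022000e0ee00;
    0xe000000e22020000e020e000; 0xe000000e2e0e0000e0e02000;
    0xe000002000200022200002e0; 0xe0000020002000e2e0000e20;
    0xe0000020ee02020e00000020; 0xe00000e000e0002ee00002e0;
    0xe00000e000e000ee20000e20; 0xe00000e0e20e0e02000000e0;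
    0xe000220e002e000020000e00; 0xe000222000022e0000020000;
    0xe0002e0e00e2000020000200; 0xe0002ee0000ee200000e0000;
    0xe0020000000200e200e020e0; 0xe0020000000e002e0020e020;
    0xe0020000e200220020020000; 0xe0020000ee00ee00200e0000;
    0xe00222e20000000000202000; 0xe0022e220000000000e0e000;
    0xe00e00000002002200202020; 0xe00e0000000e00ee00e0e0e0;
    0xe00e002222e0000000000e00; 0xe00e00e22e20000000000200;
    0xe00e220000000202e00000e0; 0xe00e2e0000000e0ee0000020;
    0xe0200002000e2000e002000e; 0xe02000202e0000e02000000e;
    0xe02000e00022020000000e0e; 0xe02000e0ee0000e0e0000002;
    0xe022002e0000000e000000e2; 0xe02e000000000e002020e002;
    0xe0e000020002e000e00e000e; 0xe0e0002000ee0e000000020e;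
    0xe0e00020e2000020e0000002; 0xe0e000e0220000202000000e;
    0xe0e200ee0000000200000022; 0xe0ee00000000020020e02002;
    0xe2000020000e020002202000; 0xe20000e000020e000ee0e000;
    0xe2020000220e00e00e000000; 0xe20200002e02002002000000;
    0xe20e002e0000e0000e0e0000; 0xe20e00ee0000200002020000;
    0xe2200002000002200e000002; 0xe2e0000200000ee002000002;
    0xee0000020002000e220000e0; 0xee000002000e00022e000020;
    0xee02000000200200ee000200; 0xee02000000e00e00e2000e00;
    0xee0e0000e20200e00e000000; 0xee0e0000ee0e002002000000;
    0xee20000e00000e200e00000e; 0xeee0000e000002e00200000e]%num.

Definition digit (d : BinNums.N) : Z :=
  let z := Z.of_N d in if z <? 8 then z else z - 16.

Fixpoint decode_rec k (a : BinNums.N) (acc : seq Z) : seq Z :=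
  if k is k'.+1 then
    decode_rec k' (BinNat.N.shiftr a 4) (digit (BinNat.N.land a 15) :: acc)
  else acc.

Definition sparse_vectors : seq (seq Z) :=
  [seq decode_rec 24 a [::] | a <- sparse_codes].

(** A decision procedure for minimal vectors with even entries: [m] is 0, and the codeword is read
    off the second binary digits. *)
Definition even_leech_min (x : seq Z) : bool :=
  [&& all Z.even x, golay [seq Z.odd (Z.div2 a) | a <- x],
      zsum x mod 8 =? 0 & dot x x =? 32].

Lemma even_leech_minP x : even_leech_min x -> leech_min x.
Proof.
case/and4P=> ex gx /Z.eqb_eq zx /Z.eqb_eq nx; split=> //.
exists 0, [seq Z.odd (Z.div2 a) | a <- x]; split=> //; last first.
  by exists (zsum x / 8); have := Z_div_mod_eq_full (zsum x) 8; lia.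
elim: x ex {gx zx nx} => [_|a x IH] /=; first exact: residues_nil.
case/andP=> ea /IH rx.
have ha := Zdiv2_odd_eqn a; have hb := Zdiv2_odd_eqn (Z.div2 a).
rewrite -Z.negb_even ea /= in ha.
have e : a = 0 + 2 * Z.b2z (Z.odd (Z.div2 a)) + 4 * Z.div2 (Z.div2 a).
  by rewrite {1}ha {1}hb /Z.b2z; lia.
have := residues_cons (Z.odd (Z.div2 a)) (Z.div2 (Z.div2 a)) rx.
by rewrite -e.
Qed.

Fixpoint pairwise_dot_le (d : Z) (T : seq (seq Z)) : bool :=
  if T is x :: T' then all (fun y => dot x y <=? d) T' && pairwise_dot_le d T'
  else true.

Lemma pairwise_dot_leP d T x y : pairwise_dot_le d T ->
  x \in T -> y \in T -> x <> y -> dot x y <= d.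
Proof.
elim: T => //= z T IH /andP[/allP hz /IH {}IH].
rewrite !inE => /predU1P[->|xT] /predU1P[->|yT] xy //.
- by apply/Z.leb_le/hz.
- by rewrite dotC; apply/Z.leb_le/hz.
- exact: IH.
Qed.

(** At norm 32, the bound 8 is the inner product 1/4 of unit vectors. *)
Definition sparse (T : seq (seq Z)) : Prop :=
  (forall x, x \in T -> leech_min x) /\
  (forall x y, x \in T -> y \in T -> x <> y -> dot x y <= 8).

Lemma sparse_vectors_check :
  all even_leech_min sparse_vectors && pairwise_dot_le 8 sparse_vectors.
Proof. by vm_cast_no_check (erefl true). Qed.

Lemma sparse_vectors_sparse : sparse sparse_vectors.
Proof.
have /andP[/allP hm hd] := sparse_vectors_check.
split=> [x /hm/even_leech_minP //|x y]; exact: pairwise_dot_leP.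
Qed.

Definition move_coords (p : seq nat) (T : seq (seq Z)) : seq (seq Z) :=
  map (coord_map 0 p) T.

Lemma sparse_move_coords p T : golay_perm p -> sparse T ->
  sparse (move_coords p T).
Proof.
move=> gp [mT dT]; split=> [x /mapP[x' hx ->]|].
  by apply: leech_min_coord_map => //; apply: mT.
move=> x y /mapP[x' hx ->] /mapP[y' hy ->] xy.
have [[lx _] [ly _]] := (mT _ hx, mT _ hy).
rewrite (dot_coord_map gp.1) ?leech_size //.
by apply: dT => // exy; apply: xy; rewrite exy.
Qed.

(** There are 23 + 19 = 42 copies, one for each triangle in E7; smaller root systems use an initial
    segment. *)
Definition copies : seq (seq (seq Z)) :=
  traject (move_coords shift_perm) sparse_vectors 23 ++
  traject (move_coords shift_perm) (move_coords double_perm sparse_vectors) 19.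

Lemma sparse_copies T : T \in copies -> sparse T.
Proof.
have sparse_traject T0 n : sparse T0 ->
    T \in traject (move_coords shift_perm) T0 n -> sparse T.
  elim: n T0 => //= n IH T0 sT0; rewrite inE => /predU1P[->//|]; apply: IH.
  by apply: sparse_move_coords => //; apply: golay_shift.
rewrite /copies mem_cat => /orP[]; apply: sparse_traject.
  exact: sparse_vectors_sparse.
apply: sparse_move_coords; first exact: golay_double.
exact: sparse_vectors_sparse.
Qed.

(** * Making the copies disjoint by sorting *)

Fixpoint lexcmp (x y : seq Z) : comparison :=
  match x, y with
  | [::], [::] => Eq
  | [::], _ => Lt
  | _, [::] => Gt
  | a :: x', b :: y' => match a ?= b with Eq => lexcmp x' y' | c => c end
  end.

Definition tagged_le (u v : seq Z * nat) : bool :=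
  match lexcmp u.1 v.1 with Lt => true | Eq => (u.2 <= v.2)%N | Gt => false end.

Definition lexlt (x y : seq Z) : bool :=
  if lexcmp x y is Lt then true else false.

(* Removes repeated vectors from a sorted list, keeping their least tag. *)
Fixpoint keep_first (u : seq Z * nat) (s : seq (seq Z * nat)) :=
  if s is v :: s' then
    if lexcmp u.1 v.1 is Eq then keep_first u s' else u :: keep_first v s'
  else [:: u].

Definition first_tags (s : seq (seq Z * nat)) : seq (seq Z * nat) :=
  if s is u :: s' then keep_first u s' else [::].

Definition tag_all (Ts : seq (seq (seq Z))) : seq (seq Z * nat) :=
  flatten [seq [seq (x, p.2) | x <- p.1] | p <- zip Ts (iota 0 (size Ts))].

(** Each vector goes to the first copy that contains it. Hence the entries with tag below [m] list
    the union of the first [m] copies, whatever [m] is, and one sorted list serves all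
    dimensions. *)
Definition owners (Ts : seq (seq (seq Z))) : seq (seq Z * nat) :=
  first_tags (sort tagged_le (tag_all Ts)).

Lemma lexlt_irr : irreflexive lexlt.
Proof. by rewrite /lexlt; elim=> //= a x; rewrite Z.compare_refl. Qed.

Lemma lexlt_trans : transitive lexlt.
Proof.
move=> y x z; rewrite /lexlt; elim: x y z => [|a x IH] [|b y] [|c z] //=.
case: (Z.compare_spec a b) => // [->|ab]; case: (Z.compare_spec b c) => // bc.
- exact: IH.
- by rewrite bc in ab; case: (Z.compare_spec a c) => //; lia.
- by case: (Z.compare_spec a c) => //; lia.
Qed.

Lemma mem_keep_first u s : {subset keep_first u s <= u :: s}.
Proof.
elim: s u => [|v s IH] u w //=.
have hu := IH u w; have hv := IH v w; move: hu hv; rewrite !inE => hu hv.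
case: lexcmp; first by move/hu/orP=> [] ->; rewrite ?orbT.
all: by rewrite inE => /orP[|/hv/orP[]] ->; rewrite ?orbT.
Qed.

(** Sorting and removing repetitions create no new pairs, so a tag still names a copy containing its
    vector. *)
Lemma mem_owners Ts u : u \in owners Ts ->
  (u.2 < size Ts)%N /\ u.1 \in nth [::] Ts u.2.
Proof.
have hu : u \in tag_all Ts -> (u.2 < size Ts)%N /\ u.1 \in nth [::] Ts u.2.
  case/flattenP => s /mapP[p hp ->] /mapP[x hx ->] /=.
  have [i] := nthP ([::], 0%N) hp; rewrite size_zip size_iota minnn => iT.
  rewrite nth_zip ?size_iota // nth_iota // add0n => ep.
  by move: hx; rewrite -ep.
move=> ou; apply: hu; rewrite -(mem_sort tagged_le).
move: ou; rewrite /owners; move: (sort _ _) => [//|v s]; exact: mem_keep_first.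
Qed.

Definition owned_ge (s : seq (seq Z * nat)) (m : nat) (n : BinNums.N) : bool :=
  (nat_of_bin n <= size [seq u <- s | (u.2 < m)%N])%N.

(** Strict sortedness, checked on the computed list, will give distinctness. For each number of
    blocks (1, 2, 4, 8, 12, 24, 42) the threshold is the desired gain over 196560, divided by 2 when
    the blocks are triangles. *)
Lemma owners_check : let s := owners copies in
  [&& sorted lexlt (map fst s), owned_ge s 1 488%num, owned_ge s 2 976%num,
      owned_ge s 4 1708%num, owned_ge s 8 3904%num, owned_ge s 12 5856%num,
      owned_ge s 24 11712%num & owned_ge s 42 18157%num].
Proof. by vm_cast_no_check (erefl true). Qed.

(** * Lifting to higher dimension *)

Fixpoint vmul (x y : seq Z) : seq Z :=
  if x is a :: x' then if y is b :: y' then a * b :: vmul x' y' else [::]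
  else [::].

(* The form [sum_i w_i y_i z_i], that is, the inner product of vectors with
   coordinates [sqrt w_i * y_i]. *)
Definition wdot (w y z : seq Z) : Z := dot (vmul w y) z.

Lemma size_vmul x y : (size (vmul x y) <= size x)%N.
Proof. by elim: x y => [|a x IH] [|b y] //=; rewrite ltnS. Qed.

Lemma nth_vmul x y i : nth 0 (vmul x y) i = nth 0 x i * nth 0 y i.
Proof.
elim: x y i => [|a x IH] [|b y] [|i] //=; rewrite ?nth_nil ?Z.mul_0_r //.
Qed.

(* Vectors from different members of [Ys] are at angle at least 60 degrees, and
   distinct vectors of the same member at angle at least 120 degrees. *)
Definition lift_system (k : nat) (w : seq Z) (n : Z) (c : nat)
    (Ys : seq (seq (seq Z))) : bool :=
  [&& size w == k, all (Z.leb 0) w, 0 <? n,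
      all (fun Y => [&& size Y == c.+1, uniq Y
                      & all (fun y => wdot w y y =? n) Y]) Ys
    & all (fun i => all (fun j => all (fun y => all (fun z =>
        if i == j then (y == z) || (2 * wdot w y z <=? - n)
        else 2 * wdot w y z <=? n)
      (nth [::] Ys j)) (nth [::] Ys i)) (iota 0 (size Ys))) (iota 0 (size Ys))].

(** Here [d] is the inner product of the base vectors and [q] that of the fibre vectors. The cases
    are: same base vector, same block with different base vectors, different blocks. Each attains
    24n in its extreme case. *)
Lemma lift_bound n d q : 0 < n ->
  [\/ d = 32 /\ 2 * q <= - n, d <= 8 /\ q <= n | d <= 16 /\ 2 * q <= n] ->
  n * d + 16 * q <= 24 * n.
Proof. by move=> n0 [] []; nia. Qed.

Section Lift.
Variable R : realType.

Definition zr (z : Z) : R := ((int_of_Z z)%:~R)%R.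

Lemma zrD a b : zr (a + b) = (zr a + zr b)%R.
Proof. by rewrite /zr -intrD; congr (_%:~R)%R; rewrite -raddfD. Qed.

Lemma zrM a b : zr (a * b) = (zr a * zr b)%R.
Proof. by rewrite /zr -intrM; congr (_%:~R)%R; rewrite -rmorphM. Qed.

Lemma zr_le a b : a <= b -> (zr a <= zr b)%R.
Proof. by move=> ab; rewrite /zr ler_int; lia. Qed.

(** Entries beyond the end of either list default to 0, so only the first length has to be
    bounded. *)
Lemma zr_dot n x y : (size x <= n)%N ->
  zr (dot x y) = (\sum_(i < n) zr (nth Z0 x i) * zr (nth Z0 y i))%R.
Proof.
elim: n x y => [|n IH] [|a x] y //= sx; first by rewrite big_ord0.
  by rewrite big1 // => i _; rewrite nth_nil mul0r.
case: y => [|b y]; first by rewrite big1 // => i _; rewrite nth_nil mulr0.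
by rewrite big_ord_recl /= zrD zrM (IH _ y).
Qed.

Variables (k : nat) (w : seq Z) (n : Z) (c : nat) (Ys : seq (seq (seq Z))).
Hypothesis system : lift_system k w n c Ys.

Let size_w : size w = k. Proof. by case/and5P: system => /eqP. Qed.

Let n_gt0 : 0 < n. Proof. by case/and5P: system => _ _ /Z.ltb_lt. Qed.

Let w_ge0 i : (0 <= zr (nth Z0 w i))%R.
Proof.
have [iw|wi] := ltnP i (size w); last by rewrite nth_default.
case/and5P: system => _ /allP/(_ _ (mem_nth 0 iw))/Z.leb_le w0 _ _ _.
exact: (@zr_le 0).
Qed.

Let lift_block i : (i < size Ys)%N -> let Y := nth [::] Ys i in
  [/\ size Y = c.+1, uniq Y & forall y, y \in Y -> wdot w y y = n].
Proof.
move=> iY; case/and5P: system => _ _ _ /allP/(_ _ (mem_nth [::] iY)) + _.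
case/and3P=> /eqP sY uY /allP nY; by split=> // y /nY/Z.eqb_eq.
Qed.

Let lift_pair i j y z : (i < size Ys)%N -> (j < size Ys)%N ->
  y \in nth [::] Ys i -> z \in nth [::] Ys j ->
  if i == j then y = z \/ 2 * wdot w y z <= - n else 2 * wdot w y z <= n.
Proof.
move=> iY jY yi zj; case/and5P: system => _ _ _ _ /allP/(_ i).
rewrite mem_iota => /(_ iY)/allP/(_ j); rewrite mem_iota => /(_ jY).
move/allP/(_ y yi)/allP/(_ z zj); case: ifP => _; last by move/Z.leb_le.
by case/orP=> [/eqP|/Z.leb_le]; [left | right].
Qed.

(* A pair [(x, [::])] is the vector [x / sqrt 32] of the original space; for
   nonempty [y], the pair [(x, y)] is the lifted vector
   [sqrt (2/3) x / sqrt 32 + sqrt (1/3) y / sqrt n]. *)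
Definition base_scale (y : seq Z) : R :=
  Num.sqrt (if y is [::] then 32^-1 else 48^-1)%R.

Definition fibre_scale : R := Num.sqrt (3 * zr n)^-1.

Definition lift_point (p : seq Z * seq Z) : 'rV[R]_(24 + k) := row_mx
  (\row_i (base_scale p.2 * zr (nth Z0 p.1 i)))%R
  (\row_j (fibre_scale * Num.sqrt (zr (nth Z0 w j)) * zr (nth Z0 p.2 j)))%R.

(** In the fibre part every square root occurs twice. The two base scales stay separate because one
    vector may be lifted and the other not. *)
Lemma dotp_lift_point p q : size p.1 = 24%N ->
  dotp (lift_point p) (lift_point q) =
  (base_scale p.2 * base_scale q.2 * zr (dot p.1 q.1) +
   (3 * zr n)^-1 * zr (wdot w p.2 q.2))%R.
Proof.
move=> sp; rewrite /dotp big_split_ord /=; congr (_ + _)%R.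
  rewrite (@zr_dot 24) ?sp // mulr_sumr; apply: eq_bigr => i _.
  by rewrite !row_mxEl !mxE mulrACA.
have swy : (size (vmul w p.2) <= k)%N by rewrite -size_w size_vmul.
rewrite (zr_dot _ swy) mulr_sumr; apply: eq_bigr => i _.
rewrite !row_mxEr !mxE nth_vmul zrM.
have fE : (fibre_scale * fibre_scale = (3 * zr n)^-1)%R.
  rewrite -expr2 sqr_sqrtr // invr_ge0 mulr_ge0 //.
  by apply: (@zr_le 0); lia.
have wE : (Num.sqrt (zr (nth Z0 w i)) * Num.sqrt (zr (nth Z0 w i)) =
    zr (nth Z0 w i))%R by rewrite -expr2 sqr_sqrtr.
have key (f s a b : R) : (f * s * a * (f * s * b) = f * f * (s * s * a * b))%R.
  by ring.
by rewrite key fE wE.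
Qed.

(** The union of the sets S_i: an entry [(x, i)] puts x into S_i, to be lifted along block [i] of
    [Ys]. *)
Variable Xs : seq (seq Z * nat).
Hypothesis Xs_uniq : uniq (map fst Xs).
Hypothesis Xs_min : forall u, u \in Xs -> leech_min u.1.
Hypothesis Xs_tag : forall u, u \in Xs -> (u.2 < size Ys)%N.
Hypothesis Xs_dot : forall u v, u \in Xs -> v \in Xs -> u.2 = v.2 ->
  u.1 <> v.1 -> dot u.1 v.1 <= 8.

Let Xs_inj u v : u \in Xs -> v \in Xs -> u.1 = v.1 -> u = v.
Proof.
move=> uX vX uv; have [i iX ui] := nthP u uX; have [j jX vj] := nthP u vX.
have : nth u.1 (map fst Xs) i == nth u.1 (map fst Xs) j.
  by rewrite !(nth_map u) // ui vj uv.
by rewrite nth_uniq ?size_map // => /eqP ij; rewrite -ui -vj ij.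
Qed.

Definition fixed_pairs : seq (seq Z * seq Z) :=
  [seq (x, [::]) | x <- leech_vectors & x \notin map fst Xs].
Definition lifted_pairs : seq (seq Z * seq Z) :=
  [seq (u.1, y) | u <- Xs, y <- nth [::] Ys u.2].

Lemma fixed_pairsP p : p \in fixed_pairs ->
  [/\ leech_min p.1, p.2 = [::] & p.1 \notin map fst Xs].
Proof.
case/mapP=> x; rewrite mem_filter => /andP[xX xL] ->; split=> //.
exact: leech_vectors_min.
Qed.

(** A fibre vector has positive norm [n], so it is never the empty list that marks unlifted
    vectors. *)
Lemma lifted_pairsP p : p \in lifted_pairs -> exists2 u, u \in Xs &
  [/\ p.1 = u.1, p.2 \in nth [::] Ys u.2 & exists a y, p.2 = a :: y].
Proof.
case/allpairsPdep=> u [y [uX yY ->]]; exists u => //; split=> //=.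
have [_ _ nY] := lift_block (Xs_tag uX).
case: y yY => [/nY|a y _]; last by exists a, y.
by rewrite /wdot; case: (w) => [|? ?] /= n0; move: n_gt0; rewrite -n0.
Qed.

Let pairs_size p : p \in fixed_pairs ++ lifted_pairs -> size p.1 = 24%N.
Proof.
rewrite mem_cat => /orP[/fixed_pairsP[[/leech_size]]//|].
by case/lifted_pairsP=> u /Xs_min[/leech_size su _] [->].
Qed.

Let n_pos : (0 < zr n)%R.
Proof. by rewrite /zr ltr0z; lia. Qed.

Lemma base_scale_sqr y : (base_scale y * base_scale y =
  if y is [::] then 32^-1 else 48^-1)%R.
Proof.
by rewrite -expr2 sqr_sqrtr //; case: y => *; rewrite invr_ge0 ler0n.
Qed.

Lemma base_scale_ge0 y : (0 <= base_scale y)%R.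
Proof. exact: sqrtr_ge0. Qed.

Lemma base_scale_le y : (base_scale y <= base_scale [::])%R.
Proof.
case: y => // a y; apply: ler_wsqrtr.
by rewrite lef_pV2 ?posrE ?ltr0n ?ler_nat.
Qed.

Lemma dotp_lifted_pairs p q : p \in lifted_pairs -> q \in lifted_pairs ->
  dotp (lift_point p) (lift_point q) =
  (zr (n * dot p.1 q.1 + 16 * wdot w p.2 q.2) / (48 * zr n))%R.
Proof.
move=> pL qL; have sp := @pairs_size p; rewrite mem_cat pL orbT in sp.
rewrite dotp_lift_point ?sp //.
have [_ _ [_ _ [a [y py]]]] := lifted_pairsP pL.
have [_ _ [_ _ [b [z qz]]]] := lifted_pairsP qL.
(* The scale depends only on emptiness, so both factors may be written with the same nonempty list
   and then squared. *)
have -> : base_scale p.2 = base_scale (a :: y) by rewrite py.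
have -> : base_scale q.2 = base_scale (a :: y) by rewrite qz.
rewrite base_scale_sqr zrD !zrM.
have -> : zr 16 = 16%R by [].
have nz : zr n != 0%R by rewrite gt_eqF.
by field.
Qed.

Lemma lift_point_unit p : p \in fixed_pairs ++ lifted_pairs ->
  dotp (lift_point p) (lift_point p) = 1%R.
Proof.
move=> pP; have sp := pairs_size pP; move: pP; rewrite mem_cat => /orP[pF|pL].
  have [[_ np] p0 _] := fixed_pairsP pF.
  rewrite dotp_lift_point // p0 base_scale_sqr np /wdot.
  have -> : dot (vmul w [::]) [::] = 0 by case: (w).
  rewrite [zr 0](_ : _ = 0%R) // [zr 32](_ : _ = 32%R) //.
  by rewrite mulr0 addr0 mulVf // pnatr_eq0.
have [u uX [e1 hp _]] := lifted_pairsP pL; have [_ np] := Xs_min uX.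
have [_ _ nY] := lift_block (Xs_tag uX).
rewrite dotp_lifted_pairs // e1 np (nY _ hp).
have -> : n * 32 + 16 * n = 48 * n by lia.
rewrite zrM [zr 48](_ : _ = 48%R) // divff // mulf_neq0 ?gt_eqF //.
Qed.

Lemma lift_point_dotp_le p q : p \in fixed_pairs ++ lifted_pairs ->
  q \in fixed_pairs ++ lifted_pairs -> p <> q ->
  (dotp (lift_point p) (lift_point q) <= 1 / 2)%R.
Proof.
(* If one vector is unlifted, the fibre part vanishes and the base vectors are distinct, so the
   product is at most 16/32. *)
have fixed_case p' q' : p' \in fixed_pairs ->
    q' \in fixed_pairs ++ lifted_pairs -> p' <> q' ->
    (dotp (lift_point p') (lift_point q') <= 1 / 2)%R.
  move=> pF qP pq; have [mp p0 pX] := fixed_pairsP pF.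
  have sp := @pairs_size p'; rewrite mem_cat pF in sp.
  have d16 : dot p'.1 q'.1 <= 16.
    move: qP; rewrite mem_cat => /orP[/fixed_pairsP[mq q0 _]|].
      apply: leech_min_dot => // e; apply: pq.
      by rewrite [p']surjective_pairing [q']surjective_pairing e p0 q0.
    case/lifted_pairsP=> u uX [e1 _ _]; apply: leech_min_dot => //.
      by rewrite e1; apply: Xs_min.
    by rewrite e1 => e; move: pX; rewrite e map_f.
  rewrite dotp_lift_point ?sp // p0 /wdot.
  have -> : dot (vmul w [::]) q'.2 = 0 by case: (w).
  rewrite [zr 0](_ : _ = 0%R) // mulr0 addr0.
  have s0 : (0 <= base_scale [::] * base_scale q'.2)%R.
    by rewrite mulr_ge0 ?base_scale_ge0.
  have s1 : (base_scale [::] * base_scale q'.2 <= 32^-1)%R.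
    rewrite -(base_scale_sqr [::]).
    by rewrite ler_wpM2l ?base_scale_ge0 ?base_scale_le.
  have := zr_le d16; rewrite [zr 16](_ : _ = 16%R) // => d16R.
  (* The base inner product may be negative, so it is raised to 16 before the scales are bounded by
     1/32. *)
  apply: (@le_trans _ _ (base_scale [::] * base_scale q'.2 * 16)%R).
    exact: ler_wpM2l.
  by lra.
move=> pP qP pq; move: (pP) (qP); rewrite !mem_cat.
case/orP=> [pF _|pL]; first exact: fixed_case.
case/orP=> [qF|qL].
  rewrite /dotp; under eq_bigr do rewrite mulrC.
  by apply: fixed_case => // qp; apply: pq.
rewrite dotp_lifted_pairs // ler_pdivrMr ?mulr_gt0 //.
have [u uX [e1 yu _]] := lifted_pairsP pL.
have [v vX [f1 zv _]] := lifted_pairsP qL.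
have hyz := lift_pair (Xs_tag uX) (Xs_tag vX) yu zv.
have ub : n * dot p.1 q.1 + 16 * wdot w p.2 q.2 <= 24 * n.
  have [nY1 nY2] : wdot w p.2 p.2 = n /\ 0 < n.
    by have [_ _ nY] := lift_block (Xs_tag uX); rewrite nY.
  rewrite e1 f1; apply: lift_bound => //.
  case: (boolP (u.1 == v.1)) => [/eqP euv|/eqP nuv].
    have uv := Xs_inj uX vX euv; subst v; rewrite eqxx in hyz.
    have [_ ->] := Xs_min uX; case: hyz => [yz|hyz]; last by constructor 1.
    by case: pq; rewrite [p]surjective_pairing [q]surjective_pairing e1 f1 yz.
  move: hyz; case: ifP => [/eqP t|_] hyz; last first.
    constructor 3; split=> //.
    exact: leech_min_dot (Xs_min uX) (Xs_min vX) nuv.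
  constructor 2; split; first exact: Xs_dot.
  (* Different base vectors of one block may carry the same fibre vector, of norm [n]; otherwise the
     fibre product is at most -n/2. *)
  case: hyz => [<-|hyz]; first by rewrite nY1; apply: Z.le_refl.
  by clear - nY2 hyz; lia.
have := zr_le ub; rewrite [zr (24 * n)]zrM [zr 24](_ : _ = 24%R) //.
by lra.
Qed.

Lemma pairs_uniq : uniq (fixed_pairs ++ lifted_pairs).
Proof.
rewrite cat_uniq; apply/and3P; split.
- rewrite map_inj_uniq; last by move=> x y [].
  exact/filter_uniq/leech_vectors_uniq.
- apply/hasPn => p /lifted_pairsP[u _ [_ _ [a [y py]]]]; apply/negP.
  by case/fixed_pairsP=> _ p0 _; rewrite p0 in py.
- apply: allpairs_uniq_dep; first exact: map_uniq Xs_uniq.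
    by move=> u /Xs_tag/lift_block[].
  move=> s t /allpairsPdep[u [y [uX _ ->]]] /allpairsPdep[v [z [vX _ ->]]] /=.
  by case=> /(Xs_inj uX vX) uv yz; rewrite uv yz.
Qed.

(** Each entry of [Xs] removes at most one vector from the list and contributes [c + 1] lifted
    ones. *)
Lemma size_pairs :
  (size leech_vectors + c * size Xs <= size (fixed_pairs ++ lifted_pairs))%N.
Proof.
rewrite size_cat size_map size_allpairs_dep.
have -> : sumn [seq size (nth [::] Ys u.2) | u <- Xs] = (c.+1 * size Xs)%N.
  have : all (fun u => size (nth [::] Ys u.2) == c.+1) Xs.
    by apply/allP => u /Xs_tag/lift_block[->].
  elim: (Xs) => [|u s IH] /=; first by rewrite muln0.
  by case/andP=> /eqP -> /IH ->; rewrite mulnS.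
rewrite mulSn addnA leq_add2r.
rewrite -(count_predC (mem (map fst Xs)) leech_vectors) addnC.
rewrite size_filter leq_add2l -size_filter -[leqRHS](size_map fst).
apply: uniq_leq_size; first exact/filter_uniq/leech_vectors_uniq.
by move=> x; rewrite mem_filter => /andP[].
Qed.

Lemma kissing_lift (N : BinNums.N) :
  (nat_of_bin N <= size leech_vectors + c * size Xs)%N ->
  kissing_number_ge R (24 + k) N.
Proof.
move=> hN; have {}hN := leq_trans hN size_pairs.
pose pairs := fixed_pairs ++ lifted_pairs.
pose pt (i : 'I_(nat_of_bin N)) := nth ([::], [::]) pairs i.
have ltp (i : 'I_(nat_of_bin N)) : (i < size pairs)%N.
  exact: leq_trans (ltn_ord i) hN.
have mem_pt i : pt i \in pairs by apply: mem_nth; apply: ltp.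
exists (fun i => lift_point (pt i)); split=> [i|i j ij].
  exact: lift_point_unit.
apply: lift_point_dotp_le => //; apply/eqP.
by rewrite nth_uniq ?ltp // ?pairs_uniq.
Qed.

End Lift.

(** * Triangles in root systems *)

Definition vopp (y : seq Z) : seq Z := map Z.opp y.

(** Three vectors of equal norm with sum zero are the vertices of an equilateral triangle centred at
    the origin. *)
Definition triangle (a b : seq Z) : seq (seq Z) := [:: a; b; vsub (vopp a) b].

Definition with_opposites (Ts : seq (seq (seq Z))) : seq (seq (seq Z)) :=
  flatten [seq [:: T; map vopp T] | T <- Ts].

(** For k = 7, cyclic shifts of coordinates permute the lines of the Fano plane used for E7
    below. *)
Definition with_rotations (k : nat) (Ts : seq (seq (seq Z))) :=
  flatten [seq [seq map (rot i) T | i <- iota 0 k] | T <- Ts].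

(** An antipodal pair also meets the 120 degree condition, but gains only one point per lifted
    vector. *)
Definition A1_pair : seq (seq (seq Z)) := [:: [:: [:: 1]; [:: -1]]].

(** The regular hexagon; the second coordinate is in units of sqrt 3, hence its weight 3. *)
Definition A2_triangles : seq (seq (seq Z)) :=
  with_opposites [:: triangle [:: 2; 0] [:: -1; 1]].

Definition D3_triangles : seq (seq (seq Z)) :=
  [:: triangle [:: 1; 0; 1] [:: 0; -1; -1];
      triangle [:: 1; 1; 0] [:: 0; -1; 1];
      triangle [:: 1; -1; 0] [:: 0; 1; -1];
      triangle [:: 1; 0; -1] [:: 0; 1; 1]].

Definition D4_triangles : seq (seq (seq Z)) := with_opposites
  [:: triangle [:: 1; 0; 0; -1] [:: 0; -1; 0; 1];
      triangle [:: 0; 1; 1; 0] [:: 0; 0; -1; 1];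
      triangle [:: 1; 1; 0; 0] [:: 0; -1; 1; 0];
      triangle [:: 1; 0; 0; 1] [:: 0; 0; -1; -1]].

(** Twelve disjoint triangles, covering 36 of the 40 roots. *)
Definition D5_triangles : seq (seq (seq Z)) :=
  [:: triangle [:: 0; 1; 0; 0; -1] [:: 0; 0; 0; -1; 1];
      triangle [:: 1; -1; 0; 0; 0] [:: 0; 1; 1; 0; 0];
      triangle [:: 0; 1; 0; 0; 1] [:: 0; 0; 0; 1; -1];
      triangle [:: 0; 1; -1; 0; 0] [:: 0; 0; 1; 0; -1];
      triangle [:: 1; 1; 0; 0; 0] [:: 0; -1; -1; 0; 0];
      triangle [:: 1; 0; 0; 0; -1] [:: 0; 0; 0; 1; 1];
      triangle [:: 1; 0; 0; -1; 0] [:: 0; 1; 0; 1; 0];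
      triangle [:: 1; 0; 0; 0; 1] [:: 0; -1; 0; 0; -1];
      triangle [:: 1; 0; -1; 0; 0] [:: 0; 0; 1; -1; 0];
      triangle [:: 1; 0; 0; 1; 0] [:: 0; 0; 0; -1; -1];
      triangle [:: 1; 0; 1; 0; 0] [:: 0; 0; -1; 0; 1];
      triangle [:: 0; 1; 0; -1; 0] [:: 0; 0; -1; 1; 0]].

(* The roots of E6 are those of D5, scaled by 2, and the vectors
   [(+-1, ..., +-1, +- sqrt 3)] with an even number of minus signs. *)
Definition E6_triangles : seq (seq (seq Z)) := with_opposites
  [:: triangle [:: 1; 1; 1; 1; -1; -1] [:: 0; -2; 0; 0; 2; 0];
      triangle [:: 2; 0; 0; -2; 0; 0] [:: -1; 1; 1; 1; -1; 1];
      triangle [:: 1; -1; 1; -1; -1; -1] [:: 0; 0; -2; 2; 0; 0];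
      triangle [:: 1; 1; -1; 1; 1; -1] [:: 0; 0; 0; -2; -2; 0];
      triangle [:: 2; 0; 2; 0; 0; 0] [:: 0; 0; -2; 0; -2; 0];
      triangle [:: 0; 2; 2; 0; 0; 0] [:: 0; 0; -2; 0; 2; 0];
      triangle [:: 2; 0; -2; 0; 0; 0] [:: 0; -2; 2; 0; 0; 0];
      triangle [:: 1; -1; 1; 1; -1; 1] [:: 0; 0; 0; -2; 2; 0];
      triangle [:: 1; 1; 1; 1; 1; 1] [:: 0; 0; -2; -2; 0; 0];
      triangle [:: 2; 2; 0; 0; 0; 0] [:: 0; -2; 0; 2; 0; 0];
      triangle [:: 2; 0; 0; 0; 2; 0] [:: -1; 1; 1; -1; -1; -1];
      triangle [:: 1; 1; -1; 1; -1; 1] [:: 0; -2; 0; -2; 0; 0]].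

(* The roots of E7 are the vectors with one entry [+-2], and those with entries
   [+-1] on the complement of a line [{i, i + 1, i + 3}] of the Fano plane. *)
Definition E7_triangles : seq (seq (seq Z)) := with_rotations 7
  [:: triangle [:: 1; 1; 1; 0; 0; -1; 0] [:: 0; 0; -1; 0; 1; 1; -1];
      triangle [:: 1; 1; -1; 0; 0; 1; 0] [:: 0; 0; 1; 0; -1; -1; -1];
      triangle [:: 2; 0; 0; 0; 0; 0; 0] [:: -1; 1; 1; 0; 0; 1; 0];
      triangle [:: 1; 0; 1; -1; 1; 0; 0] [:: 1; 0; -1; 1; -1; 0; 0];
      triangle [:: 1; 1; 1; 0; 0; 1; 0] [:: 0; -1; -1; 1; 0; 0; -1];
      triangle [:: 1; 1; 0; 0; -1; 0; -1] [:: 0; -1; -1; 1; 0; 0; 1]].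

Lemma root_systems :
  [/\ lift_system 1 [:: 1] 1 1 A1_pair,
      lift_system 2 [:: 1; 3] 4 2 A2_triangles,
      lift_system 3 (nseq 3 1) 2 2 D3_triangles &
      lift_system 4 (nseq 4 1) 2 2 D4_triangles] /\
  [/\ lift_system 5 (nseq 5 1) 2 2 D5_triangles,
      lift_system 6 (rcons (nseq 5 1) 3) 8 2 E6_triangles &
      lift_system 7 (nseq 7 1) 4 2 E7_triangles].
Proof. by split; split; vm_compute. Qed.

(** The lifted vectors are those owned by the first [size Ys] copies. Equal tags mean membership in
    the same sparse copy, which gives the bound 8. *)
Lemma kissing_owners (R : realType) Ts k w n c Ys (N0 N : BinNums.N) :
  (forall T, T \in Ts -> sparse T) -> sorted lexlt (map fst (owners Ts)) ->
  lift_system k w n c Ys -> owned_ge (owners Ts) (size Ys) N0 ->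
  nat_of_bin N = (nat_of_bin 196560%num + c * nat_of_bin N0)%N ->
  kissing_number_ge R (24 + k) N.
Proof.
move=> sparseT sortedT system.
pose Xs := [seq u <- owners Ts | (u.2 < size Ys)%N].
have memX u : u \in Xs -> (u.2 < size Ys)%N /\ u \in owners Ts.
  by rewrite mem_filter => /andP[].
have copy u : u \in Xs -> sparse (nth [::] Ts u.2) /\
    u.1 \in nth [::] Ts u.2.
  move=> /memX[_ /mem_owners[u2 u1]]; split=> //.
  exact/sparseT/mem_nth.
have uniqX : uniq (map fst Xs).
  apply: (sorted_uniq lexlt_trans lexlt_irr); rewrite sorted_map.
  apply: sorted_filter; last by rewrite -sorted_map.
  by move=> u v z; apply: lexlt_trans.
have minX u : u \in Xs -> leech_min u.1 by move=> /copy[[min_u _] /min_u].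
have tagX u : u \in Xs -> (u.2 < size Ys)%N by move=> /memX[].
have dotX u v : u \in Xs -> v \in Xs -> u.2 = v.2 -> u.1 <> v.1 ->
    dot u.1 v.1 <= 8.
  move=> /copy[[_ dot_u] uT] /copy[_ vT] uv nuv; apply: dot_u => //.
  by rewrite uv.
move=> hN0 eN; apply: (kissing_lift R system uniqX minX tagX dotX).
by rewrite eN size_leech_vectors leq_add2l leq_mul2l; apply/orP; right.
Qed.

Theorem theorem3p1 (R : realType) :
  kissing_number_ge R 25 197048%num /\
  kissing_number_ge R 26 198512%num /\
  kissing_number_ge R 27 199976%num /\
  kissing_number_ge R 28 204368%num /\
  kissing_number_ge R 29 208272%num /\
  kissing_number_ge R 30 219984%num /\
  kissing_number_ge R 31 232874%num.
Proof.
have /and5P[sorted_owners n1 n2 n4 /and4P[n8 n12 n24 n42]] := owners_check.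
have [[A1 A2 D3 D4] [D5 E6 E7]] := root_systems.
have kissing := kissing_owners R sparse_copies sorted_owners.
(* What remains is the arithmetic N = 196560 + c N0, with c = 1 here and c = 2 in the other
   dimensions. *)
split; first (apply: (kissing _ _ _ _ _ _ _ A1 n1); clear; lia).
split; first (apply: (kissing _ _ _ _ _ _ _ A2 n2); clear; lia).
split; first (apply: (kissing _ _ _ _ _ _ _ D3 n4); clear; lia).
split; first (apply: (kissing _ _ _ _ _ _ _ D4 n8); clear; lia).
split; first (apply: (kissing _ _ _ _ _ _ _ D5 n12); clear; lia).
split; first (apply: (kissing _ _ _ _ _ _ _ E6 n24); clear; lia).
apply: (kissing _ _ _ _ _ _ _ E7 n42); clear; lia.
Qed.
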